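(* Let $a<b$ be real numbers and let $f:[a,b]\to\mathbb{R}$ be a function that is differentiable on $(a,b)$. If $f'\in L[a,b]$, then for all $x\in[a,b]$ and all $\alpha>0$, $$\left(\frac{(x-a)^{\alpha}+(b-x)^{\alpha}}{b-a}\right)f(x)-\frac{\Gamma(\alpha+1)}{b-a}\left[J_{x-}^{\alpha}f(a)+J_{x+}^{\alpha}f(b)\right]$$ $$=\frac{(x-a)^{\alpha+1}}{b-a}\int_{0}^{1}t^{\alpha}f'\left(tx+(1-t)a\right)dt-\frac{(b-x)^{\alpha+1}}{b-a}\int_{0}^{1}t^{\alpha}f'\left(tx+(1-t)b\right)dt.$$
   Context: $L[a,b]$ denotes the space of Lebesgue integrable functions on $[a,b]$. $\Gamma(\alpha)=\int_0^\infty e^{-u}u^{\alpha-1}du$ is the Euler Gamma function. For $\alpha>0$ the Riemann-Liouville fractional integrals are $J_{c+}^{\alpha}f(y)=\frac{1}{\Gamma(\alpha)}\int_c^y (y-t)^{\alpha-1}f(t)\,dt$ for $y>c$ and $J_{d-}^{\alpha}f(y)=\frac{1}{\Gamma(\alpha)}\int_y^d (t-y)^{\alpha-1}f(t)\,dt$ for $y<d$. Thus $J_{x-}^{\alpha}f(a)=\frac{1}{\Gamma(\alpha)}\int_a^x (t-a)^{\alpha-1}f(t)\,dt$ and $J_{x+}^{\alpha}f(b)=\frac{1}{\Gamma(\alpha)}\int_x^b (b-t)^{\alpha-1}f(t)\,dt$; when $x=a$ (respectively $x=b$) the first (respectively second) is an integral over a degenerate interval and equals $0$. Likewise, a term on the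 right-hand side with coefficient $(x-a)^{\alpha+1}=0$ or $(b-x)^{\alpha+1}=0$ is taken to be $0$.
   Formalization: When x = a, f is also assumed right-continuous at a, and when x = b, left-continuous at b; without this the identity fails (e.g. f equal to 1 at a and 0 elsewhere, x = a). For a < x < b nothing is added. *)

(* Defs.v *)
From HB Require Import structures.
From mathcomp Require Import all_boot all_order all_algebra.
From mathcomp Require Import all_classical all_reals all_analysis.
Import Order.TTheory GRing.Theory Num.Theory.
Import numFieldNormedType.Exports.

Set Implicit Arguments.
Unset Strict Implicit.
Unset Printing Implicit Defensive.

Local Open Scope ring_scope.
Local Open Scope classical_set_scope.

(* Integrals are over closed intervals, where [0 `^ p] is the junk value 0 for
   p < 0; this affects the integrands at a single point only. Likewise the
   integral over a degenerate interval [c, c] is 0. *)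

Definition EulerGamma (R : realType) (alpha : R) : R :=
  \int[lebesgue_measure]_(u in `[0, +oo[) (expR (- u) * u `^ (alpha - 1)).

(* J_{c+}^alpha f (y) *)
Definition RL_left (R : realType) (alpha c : R) (f : R -> R) (y : R) : R :=
  (EulerGamma alpha)^-1 *
  \int[lebesgue_measure]_(t in `[c, y]) ((y - t) `^ (alpha - 1) * f t).

(* J_{d-}^alpha f (y) *)
Definition RL_right (R : realType) (alpha d : R) (f : R -> R) (y : R) : R :=
  (EulerGamma alpha)^-1 *
  \int[lebesgue_measure]_(t in `[y, d]) ((t - y) `^ (alpha - 1) * f t).

(* Main.v *)
Require Import Defs.
From HB Require Import structures.
From mathcomp Require Import all_boot all_order all_algebra.
From mathcomp Require Import all_classical all_reals all_analysis.
From mathcomp Require Import measurable_realfun ring lra.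
Import Order.TTheory GRing.Theory Num.Theory.
Import numFieldNormedType.Exports.

Set Implicit Arguments.
Unset Strict Implicit.
Unset Printing Implicit Defensive.

Local Open Scope ring_scope.
Local Open Scope classical_set_scope.

(** The difficulty is that f is differentiable at every interior point but f'
    is merely integrable, so the fundamental theorem of calculus for C^1
    functions does not apply.  The stronger statement that does apply says that
    an everywhere differentiable F whose derivative is Lebesgue integrable
    satisfies
      int_a^b F' = F(b-) - F(a+)                         ([FTC2_integrable]).
    It rests on the Vitali-Caratheodory idea: given phi >= 0 integrable and
    eps > 0, one adds to phi a nonnegative S of integral at most eps such that
    phi(x) <= phi(y) + eps + S(y) for all y near x ([vitali_caratheodory]).
    If F' <= phi, then F - int (phi + eps + S) - eps * id decreases around each
    point, hence decreases globally ([nonincreasing_of_local]), and eps -> 0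
    gives the increment bound F(d) - F(c) <= int phi.  Truncating F' from below
    and passing to the limit by dominated convergence gives
    F(b-) - F(a+) <= int F', and -F gives the reverse inequality.

    Applied to t^p F(t) on (0, b), whose limit at 0 vanishes because F is
    bounded, the theorem is an integration by parts:
      p int_0^b t^(p-1) F = b^p F(b-) - int_0^b t^p F'   ([powR_by_parts]).
    Both weighted integrals of the theorem are instances on (0, 1), with
    F(t) = f(t x + (1 - t) c) and c = a or c = b.  The slope k = x - c is
    positive in the first case and negative in the second, and an affine change
    of variables by k turns int_0^1 t^(alpha-1) F into the fractional integral
    ([fractional_segment_identity]).

    The factor Gamma(alpha + 1) / Gamma(alpha) = alpha comes from the same
    integration by parts with F(t) = exp(-t) on (0, n), letting n tend to
    infinity ([EulerGamma_rec]). *)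

(** * Bounding increments by the integral of a majorant of the derivative *)

(** The supremum s of the points y of [c, d] with H y <= H c is such a point, by
    the local property to the left of s, and it cannot be smaller than d, by the
    local property to the right. *)
Lemma nonincreasing_of_local (R : realType) (H : R -> R) (c d : R) :
  c <= d ->
  (forall x, c <= x <= d -> \forall y \near x, c <= y <= d ->
    (x <= y -> H y <= H x) /\ (y <= x -> H x <= H y)) ->
  H d <= H c.
Proof.
move=> cd loc.
pose A := [set y : R | c <= y <= d /\ H y <= H c].
have Ac : A c by split; rewrite ?lexx.
have ubA : ubound A d by move=> y [/andP[_ ?] _].
have supA : has_sup A by split; [exists c|exists d].
set s := sup A.
have cs : c <= s by apply: ub_le_sup => //; exists d.
have sd : s <= d by apply: ge_sup => //; exists c.
have /nbhs_ballP[e /= e0 he] : \forall y \near s, c <= y <= d ->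
  (s <= y -> H y <= H s) /\ (y <= s -> H s <= H y) by apply: loc; rewrite cs.
have Hs : H s <= H c.
  have [y Ay ye] := sup_adherent e0 supA.
  have ys : y <= s by apply: ub_le_sup => //; exists d.
  case: Ay => yI Hy; apply: le_trans Hy.
  have []// := he y _ yI.
    rewrite /ball/= ger0_norm ?subr_ge0//.
    by rewrite ltrBlDr -ltrBlDl.
  by move=> _; exact.
have [sd'|ds] := ltP s d; last by have -> : d = s by apply/eqP; rewrite eq_le ds sd.
exfalso.
pose z := Order.min d (s + e / 2).
have sz : s < z by rewrite lt_min sd' ltrDl divr_gt0.
have zs : z <= s + e / 2 by rewrite ge_min lexx orbT.
have zI : c <= z <= d by rewrite (le_trans cs (ltW sz)) ge_min lexx.
have Az : A z.
  split=> //; apply: le_trans Hs.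
  have [] // := he z _ zI.
    rewrite /ball/= distrC ger0_norm ?subr_ge0 ?(ltW sz)//.
    rewrite (@le_lt_trans _ _ (e / 2))//; first by rewrite lerBlDl.
    by rewrite ltr_pdivrMr// mulr_natr mulr2n ltrDl.
  by move=> + _; apply; exact: ltW.
have : z <= s by apply: ub_le_sup => //; exists d.
by rewrite leNgt sz.
Qed.

(** Slice the values of phi into the level sets E n of height eps and enclose
    each E n in an open set U n.  If x lies in E n and y in U n, then either y
    lies in E n and phi y is within eps of phi x, or y lies in U n \ E n, where
    S is at least (n + 1) eps > phi x. *)
Lemma vitali_caratheodory (R : realType) (phi : R -> R) (c d eps : R) :
  0 < eps -> measurable_fun `]c, d[ phi ->
  (forall x, c < x < d -> 0 <= phi x) ->
  exists S : R -> \bar R,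
  [/\ measurable_fun setT S, (forall x, 0 <= S x)%E,
      (\int[lebesgue_measure]_x S x <= eps%:E)%E &
      forall x, c < x < d -> \forall y \near x, c < y < d ->
        ((phi x)%:E <= (phi y + eps)%:E + S y)%E].
Proof.
move=> e0 mphi phi0.
pose E (n : nat) := `]c, d[ `&` phi @^-1` `[n%:R * eps, n.+1%:R * eps[.
have mE n : measurable (E n) by exact: mphi.
have Efin n : (lebesgue_measure (E n) < +oo)%E.
  apply: (@le_lt_trans _ _ (lebesgue_measure (`]c, d[ : set R))).
    apply: le_measure; rewrite ?inE//.
    - exact: mE.
    - by move=> x [].
  by rewrite lebesgue_measure_itv/=; case: ifP => // _; rewrite -EFinD ltry.
have w0 n : 0 < n.+1%:R * eps :> R by rewrite mulr_gt0.
(* measure allowed for U n \ E n, so that the n-th term of S has integral at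
   most eps / 2 ^ (n + 1) *)
pose w (n : nat) : R := (eps / (2 ^ n.+1)%:R) / (n.+1%:R * eps).
have wp n : 0 < w n by rewrite divr_gt0// divr_gt0// ltr0n expn_gt0.
have /choice[U HU] : forall n, exists U : set R,
    [/\ open U, E n `<=` U & (lebesgue_measure (U `\` E n) < (w n)%:E)%E].
  by move=> n; exact: lebesgue_regularity_outer (mE n) (Efin n) (wp n).
have mD n : measurable (U n `\` E n).
  by apply: measurableD; [apply: open_measurable; case: (HU n)|exact: mE].
pose s n (y : R) : \bar R := ((n.+1%:R * eps) * \1_(U n `\` E n) y)%:E.
have s0 n y : (0 <= s n y)%E by rewrite lee_fin mulr_ge0 ?(ltW (w0 n)).
have mi n : measurable_fun setT (EFin \o (\1_(U n `\` E n) : R -> R)).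
  by apply/measurable_EFinP; exact: measurable_indic.
have ms n : measurable_fun setT (s n).
  by apply/measurable_EFinP; apply: measurable_funM.
exists (fun y => \sum_(n <oo) s n y)%E; split.
- by apply: ge0_emeasurable_sum => // n x _ _; exact: s0.
- by move=> x; apply: nneseries_ge0 => n _ _; exact: s0.
- rewrite integral_nneseries//.
  apply: le_trans (epsilon_trick0 xpredT (ltW e0)).
  apply: lee_nneseries => [n _ _|n _]; first exact: integral_ge0.
  rewrite /s; under eq_integral do rewrite EFinM.
  rewrite ge0_integralZl_EFin ?(ltW (w0 n))//; last first.
    exact: mi.
  rewrite integral_indic ?setIT//; last exact: mD.
  have [_ _ /ltW h] := HU n.
  apply: (@le_trans _ _ ((n.+1%:R * eps)%:E * (w n)%:E)%E).
    by rewrite lee_pmul2l// lte_fin.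
  by rewrite -EFinM lee_fin mulrC divfK// gt_eqF.
- move=> x xcd.
  pose n := Num.truncn (phi x / eps).
  have /andP[nx xn] : n%:R <= phi x / eps < n.+1%:R.
    by rewrite truncn_itv// divr_ge0 ?phi0// ltW.
  rewrite ler_pdivlMr// in nx; rewrite ltr_pdivrMr// in xn.
  have Enx : E n x by split=> //=; rewrite in_itv/= nx xn.
  have [oU EU _] := HU n.
  near=> y => ycd.
  have Uny : U n y.
    by near: y; apply: open_nbhs_nbhs; split=> //; exact: EU.
  have sy : (s n y <= \sum_(n <oo) s n y)%E.
    rewrite (@nneseriesD1 _ (s^~ y) n xpredT)//= leeDl//.
    by apply: nneseries_ge0 => k _ _; exact: s0.
  have [Eny|Eny] := pselect (E n y).
    apply: (@le_trans _ _ (phi y + eps)%:E).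
      rewrite lee_fin; case: Eny => _ /=; rewrite in_itv/= => /andP[h _].
      apply: (le_trans (ltW xn)); rewrite -natr1 mulrDl mul1r lerD2r//.
    by rewrite leeDl//; apply: nneseries_ge0 => k _ _; exact: s0.
  apply: (@le_trans _ _ (0 + s n y)%E); last first.
    apply: leeD => //; rewrite lee_fin addr_ge0 ?phi0// ltW//.
  rewrite add0e lee_fin indicE (@mem_set _ (U n `\` E n) y)// mulr1.
  exact: ltW.
Unshelve. all: by end_near. Qed.

Lemma integrable_cst_oo (R : realType) (a b k : R) :
  (@lebesgue_measure R).-integrable `]a, b[ (EFin \o fun=> k).
Proof.
apply: measurable_bounded_integrable => //=.
  by rewrite lebesgue_measure_itv/=; case: ifP => // _; rewrite -EFinD ltry.
by exists `|k|; split; [exact: num_real|move=> M kM x _; exact: ltW].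
Qed.

Lemma is_derive_near_le (R : realType) (f : R -> R) (x df e : R) :
  0 < e -> is_derive x 1 f df ->
  \forall y \near x, `|f y - f x - df * (y - x)| <= e * `|y - x|.
Proof.
move=> e0 [+ <-] => fx.
have : h^-1 *: (f (h + x) - f x) @[h --> 0^'] --> 'D_1 f x.
  move: fx; rewrite /derivable /derive.
  rewrite (_ : (fun h : R => h^-1 *: (f (h *: 1 + x) - f x)) =
               (fun h : R => h^-1 *: (f (h + x) - f x)))//.
  by apply/funext => h; rewrite [_%:A]mulr1.
move/cvgrPdist_le => /(_ _ e0)/nbhs_ballP[r /= r0 hr].
apply/nbhs_ballP; exists r => //= y xy.
have [->|yx] := eqVneq y x; first by rewrite !subrr mulr0 subr0 !normr0 mulr0.
have yx0 : y - x != 0 by rewrite subr_eq0.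
have := hr (y - x).
rewrite /ball/= sub0r normrN -normrN opprB subrK => /(_ xy yx0) h.
set d := 'D_1 f x in h *.
have -> : f y - f x - d * (y - x) =
  - ((d - (y - x)^-1 * (f y - f x)) * (y - x)) by field.
by rewrite normrN normrM (distrC x); apply: ler_wpM2r.
Qed.

(** Compare F with the indefinite integral N of g = phi + eps + S.  Near x the
    increments of N are at least phi x times the length, whereas those of F are
    at most (f x + eps) times the length; so F - N - eps * id is locally, hence
    globally, nonincreasing. *)
Lemma le_increment_Rintegral_ge0 (R : realType) (F f phi : R -> R) (a b c d : R) :
  (forall x, a < x < b -> is_derive x 1 F (f x)) ->
  (@lebesgue_measure R).-integrable `]a, b[ (EFin \o phi) ->
  (forall x, a < x < b -> 0 <= phi x) ->
  (forall x, a < x < b -> f x <= phi x) ->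
  a < c -> c <= d -> d < b ->
  F d - F c <= \int[lebesgue_measure]_(x in `]a, b[) phi x.
Proof.
move=> df iphi phi0 fphi ac cd db.
have ab : a < b by rewrite (lt_trans ac)// (le_lt_trans cd).
apply/ler_addgt0Pr => /= e e0.
(* so that the final errors eps, eps * (b - a) and eps * (d - c) add up to e *)
pose eps := e / (1 + (b - a) + (d - c)).
have k0 : 0 < 1 + (b - a) + (d - c) by lra.
have eps0 : 0 < eps by rewrite divr_gt0.
have mphi : measurable_fun `]a, b[ phi.
  by apply/measurable_EFinP; exact: (measurable_int _ iphi).
have [S [mS S0 IS Sphi]] := vitali_caratheodory eps0 mphi phi0.
pose g y := ((phi y + eps)%:E + S y)%E.
have g0 y : a < y < b -> (0 <= g y)%E.
  by move=> yab; rewrite adde_ge0// lee_fin addr_ge0 ?phi0// ltW.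
have mg : measurable_fun `]a, b[ g.
  apply: emeasurable_funD; last exact: measurable_funTS.
  by apply/measurable_EFinP; apply: measurable_funD.
pose I := \int[lebesgue_measure]_(x in `]a, b[) phi x.
pose mu := @lebesgue_measure R.
have Ig : (\int[mu]_(x in `]a, b[) g x <= (I + eps * (b - a) + eps)%:E)%E.
  rewrite ge0_integralD//=; first last.
  - exact: measurable_funTS.
  - by apply/measurable_EFinP; apply: measurable_funD.
  - by move=> x; rewrite in_itv/= => xab; rewrite lee_fin addr_ge0 ?phi0// ltW.
  rewrite [in leRHS]EFinD; apply: leeD; last first.
    apply: le_trans IS; apply: ge0_subset_integral => //.
  under eq_integral do rewrite EFinD.
  rewrite integralD//; last exact: integrable_cst_oo.
  rewrite (@integral_cst _ _ _ mu)//= /mu lebesgue_measure_itv/= lte_fin ab.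
  by rewrite -EFinD -EFinM EFinD fineK// integrable_fin_num.
have sub u v : c <= u -> v <= d -> `]u, v] `<=` `]a, b[.
  move=> cu vd x /=; rewrite !in_itv/= => /andP[ux xv].
  by rewrite (lt_trans ac (le_lt_trans cu ux)) (le_lt_trans (le_trans xv vd) db).
have mgs u v : c <= u -> v <= d -> measurable_fun `]u, v] g.
  by move=> cu vd; apply: measurable_funS mg => //; exact: sub.
have g0s u v x : c <= u -> v <= d -> `]u, v] x -> (0 <= g x)%E.
  by move=> cu vd /(sub _ _ cu vd)/=; rewrite in_itv/=; exact: g0.
pose N y := (\int[mu]_(x in `]c, y]) g x)%E.
have NK y : y <= d -> (N y <= (I + eps * (b - a) + eps)%:E)%E.
  move=> yd; apply: le_trans Ig.
  by apply: ge0_subset_integral => //=; exact: sub.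
have N0 y : y <= d -> (0 <= N y)%E.
  by move=> yd; apply: integral_ge0 => x; exact: g0s.
have Nfin y : y <= d -> N y \is a fin_num.
  by move=> yd; rewrite ge0_fin_numE ?N0// (le_lt_trans (NK y yd))// ltry.
have NB u v p : c <= u -> u <= v -> v <= d ->
    (forall x, u < x <= v -> (p%:E <= g x)%E) -> 0 <= p ->
    p * (v - u) <= fine (N v) - fine (N u).
  move=> cu uv vd pg p0.
  have -> : N v = (N u + \int[mu]_(x in `]u, v]) g x)%E.
    have E : `]c, v] = `]c, u] `|` `]u, v] :> set R.
      by apply: itv_bndbnd_setU; rewrite bnd_simp.
    rewrite /N E ge0_integral_setU//=.
    - by rewrite -E; exact: mgs.
    - by move=> x xE; apply: (g0s c v) => //; rewrite E.
    - apply/disj_setPRL => x /=; rewrite !in_itv/= => /andP[ux _].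
      by rewrite leNgt ux andbF.
  have Nuv : (\int[mu]_(x in `]u, v]) g x)%E \is a fin_num.
    rewrite ge0_fin_numE; last by apply: integral_ge0 => x; exact: g0s.
    apply: le_lt_trans (ltry (I + eps * (b - a) + eps)).
    apply: le_trans Ig; apply: ge0_subset_integral => //=; exact: sub.
  rewrite (fineD (Nfin _ (le_trans uv vd)) Nuv) addrAC subrr add0r.
  rewrite -lee_fin fineK//.
  apply: (@le_trans _ _ (\int[mu]_(x in `]u, v]) p%:E)%E).
    rewrite (@integral_cst _ _ _ mu)//= /mu lebesgue_measure_itv/= lte_fin.
    case: ifPn => [_|]; first by rewrite -EFinB -EFinM.
    by rewrite -leNgt => vu; rewrite (@le_anti _ _ u v) ?uv// subrr mulr0 mule0.
  apply: ge0_le_integral => //=.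
  exact: mgs.
pose H y := F y - fine (N y) - eps * y.
have Hdc : H d <= H c.
  apply: nonincreasing_of_local => // x /andP[cx xd].
  have xab : a < x < b by rewrite (lt_le_trans ac cx) (le_lt_trans xd db).
  have /nbhs_ballP[r1 /= r10 h1] := is_derive_near_le eps0 (df x xab).
  have /nbhs_ballP[r2 /= r20 h2] := Sphi x xab.
  pose r := Order.min r1 r2.
  have r0 : 0 < r by rewrite lt_min r10.
  apply/nbhs_ballP; exists r => //= y xy /andP[cy yd].
  have near_phi z : x <= z <= y \/ y <= z <= x -> ((phi x)%:E <= g z)%E.
    move=> hz; apply: h2; last lra.
    move: xy; rewrite /ball/= lt_min => /andP[_]; apply: le_lt_trans.
    case: hz => /andP[h h'].
      by rewrite !ler0_norm ?subr_le0 ?(le_trans h h')// !opprB lerD2r.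
    by rewrite !ger0_norm ?subr_ge0 ?(le_trans h h')// lerD2l lerN2.
  have fx := fphi x xab.
  have px := phi0 x xab.
  have H0 : `|F y - F x - f x * (y - x)| <= eps * `|y - x|.
    by apply: h1; move: xy; rewrite /ball/= lt_min => /andP[].
  split=> [xley|ylex].
  - move: H0; rewrite (ger0_norm (_ : 0 <= y - x)) ?subr_ge0// ler_norml => /andP[_ hf].
    have : phi x * (y - x) <= fine (N y) - fine (N x).
      by apply: NB => // z /andP[xz zy]; apply: near_phi; left; rewrite ltW.
    have : f x * (y - x) <= phi x * (y - x).
      by apply: ler_wpM2r => //; rewrite subr_ge0.
    rewrite /H; lra.
  - move: H0; rewrite (ler0_norm (_ : y - x <= 0)) ?subr_le0// ler_norml => /andP[hf _].
    have : phi x * (x - y) <= fine (N x) - fine (N y).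
      by apply: NB => // z /andP[yz zx]; apply: near_phi; right; rewrite ltW.
    have : f x * (x - y) <= phi x * (x - y).
      by apply: ler_wpM2r => //; rewrite subr_ge0.
    rewrite /H; lra.
have Nc : N c = 0%E by rewrite /N set_itvxx ?integral_set0//.
have : fine (N d) <= I + eps * (b - a) + eps.
  by rewrite -lee_fin fineK ?Nfin// NK.
move: Hdc; rewrite /H Nc /=.
have -> : e = eps * (1 + (b - a) + (d - c)) by rewrite divfK// gt_eqF.
rewrite -/I; move: (fine _) (I) (eps) => n J k; lra.
Qed.

(** * The fundamental theorem of calculus for integrable derivatives *)

Lemma le_limit_increment_Rintegral_ge0 (R : realType) (F f phi : R -> R)
    (a b l r : R) :
  a < b ->
  (forall x, a < x < b -> is_derive x 1 F (f x)) ->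
  (@lebesgue_measure R).-integrable `]a, b[ (EFin \o phi) ->
  (forall x, a < x < b -> 0 <= phi x) ->
  (forall x, a < x < b -> f x <= phi x) ->
  F x @[x --> a^'+] --> l -> F x @[x --> b^'-] --> r ->
  r - l <= \int[lebesgue_measure]_(x in `]a, b[) phi x.
Proof.
move=> ab dF iphi phi0 fphi Fl Fr.
apply/ler_addgt0Pr => /= e e0.
have e20 : 0 < e / 2 by rewrite divr_gt0.
pose m := (a + b) / 2.
have am : a < m by rewrite /m; lra.
have mb : m < b by rewrite /m; lra.
have [d [Fd /andP[md db]]] : exists d, `|r - F d| <= e / 2 /\ m < d < b.
  apply: (@filter_ex _ (b^'-)); near=> d; split.
    by near: d; move/cvgrPdist_le : Fr; exact.
  by apply/andP; split; near: d; [exact: nbhs_left_gt|exact: nbhs_left_lt].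
have [c [Fc /andP[ac cm]]] : exists c, `|l - F c| <= e / 2 /\ a < c < m.
  apply: (@filter_ex _ (a^'+)); near=> c; split.
    by near: c; move/cvgrPdist_le : Fl; exact.
  by apply/andP; split; near: c; [exact: nbhs_right_gt|exact: nbhs_right_lt].
have := le_increment_Rintegral_ge0 dF iphi phi0 fphi ac (ltW (lt_trans cm md)) db.
move: Fd Fc; rewrite !ler_norml => /andP[_ ?] /andP[? _].
move: (Rintegral _ _ _) => J; lra.
Unshelve. all: by end_near. Qed.

(** Adding M * id to F and the constant M to phi reduces a lower bound - M on
    phi to nonnegativity, since the interval is bounded. *)
Lemma le_limit_increment_Rintegral (R : realType) (F f phi : R -> R)
    (a b l r M : R) :
  a < b ->
  (forall x, a < x < b -> is_derive x 1 F (f x)) ->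
  (@lebesgue_measure R).-integrable `]a, b[ (EFin \o phi) ->
  (forall x, a < x < b -> - M <= phi x) ->
  (forall x, a < x < b -> f x <= phi x) ->
  F x @[x --> a^'+] --> l -> F x @[x --> b^'-] --> r ->
  r - l <= \int[lebesgue_measure]_(x in `]a, b[) phi x.
Proof.
move=> ab dF iphi phiM fphi Fl Fr.
have : (r + M * b) - (l + M * a) <=
    \int[lebesgue_measure]_(x in `]a, b[) (phi x + M).
  apply: (@le_limit_increment_Rintegral_ge0 _ (fun x => F x + M * x)
    (fun x => f x + M)) => //.
  - move=> x /dF Fx; have -> : f x + M = f x + M *: 1 by rewrite [_ *: _]mulr1.
    exact: is_deriveD.
  - rewrite (_ : _ \o _ = (EFin \o phi) \+ (EFin \o fun=> M))%E//.
    by apply: integrableD => //; exact: integrable_cst_oo.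
  - by move=> x /phiM; rewrite -subr_ge0 opprK.
  - by move=> x /fphi; rewrite lerD2r.
  - by apply: cvgD => //; apply: cvgMr; apply: cvg_at_right_filter; exact: cvg_id.
  - by apply: cvgD => //; apply: cvgMr; apply: cvg_at_left_filter; exact: cvg_id.
rewrite RintegralD//; last exact: integrable_cst_oo.
rewrite Rintegral_cst//= lebesgue_measure_itv/= lte_fin ab /=.
move: (Rintegral _ _ _) => J; lra.
Qed.

(** The truncations max f (- n) are bounded below and dominated by |f|. *)
Lemma FTC2_le (R : realType) (F f : R -> R) (a b l r : R) :
  a < b ->
  (forall x, a < x < b -> is_derive x 1 F (f x)) ->
  (@lebesgue_measure R).-integrable `]a, b[ (EFin \o f) ->
  F x @[x --> a^'+] --> l -> F x @[x --> b^'-] --> r ->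
  r - l <= \int[lebesgue_measure]_(x in `]a, b[) f x.
Proof.
move=> ab dF fi Fl Fr.
have mf : measurable_fun `]a, b[ f.
  by apply/measurable_EFinP; exact: measurable_int fi.
pose fn (n : nat) x := Num.max (f x) (- n%:R).
have mfn n : measurable_fun `]a, b[ (fn n) by exact: measurable_maxr.
have mefn n : measurable_fun `]a, b[ (EFin \o fn n) by exact/measurable_EFinP.
have mef : measurable_fun `]a, b[ (EFin \o f) by exact/measurable_EFinP.
have fnf n x : `|fn n x| <= `|f x|.
  rewrite /fn; case: (leP (f x) (- n%:R)) => // h.
  have h0 : f x <= 0 by rewrite (le_trans h)// oppr_le0.
  by rewrite normrN normr_nat ler0_norm// lerNr.
have fni n : (@lebesgue_measure R).-integrable `]a, b[ (EFin \o fn n).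
  apply: le_integrable fi => //; first exact: mefn.
  by move=> x _; rewrite lee_fin.
have [] := @dominated_convergence _ _ R (@lebesgue_measure R) `]a, b[ _
  (fun n => EFin \o fn n) (EFin \o f) (abse \o (EFin \o f)).
- by [].
- exact: mefn.
- exact: mef.
- apply: aeW => x _; apply: cvg_near_cst.
  exists (Num.truncn `|f x|).+1 => // n /= fxn.
  rewrite /fn; congr EFin; apply/max_idPl.
  rewrite lerNl (le_trans (ler_norm _))// normrN.
  rewrite (le_trans (ltW (truncnS_gt _)))// ler_nat//.
- exact: integrable_abse fi.
- by apply: aeW => x n _ /=; rewrite lee_fin.
move=> _ _ h.
rewrite -lee_fin fineK; last exact: integrable_fin_num.
apply: (cvge_to_ge h); apply: nearW => n /=.
rewrite -[leRHS]fineK; last exact: (integrable_fin_num _ (fni n)).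
rewrite lee_fin; apply: (@le_limit_increment_Rintegral _ F f (fn n) a b l r n%:R) => //.
- by move=> x _; rewrite /fn le_max lexx orbT.
- by move=> x _; rewrite /fn le_max lexx.
Qed.

Lemma FTC2_integrable (R : realType) (F f : R -> R) (a b l r : R) :
  a < b ->
  (forall x, a < x < b -> is_derive x 1 F (f x)) ->
  (@lebesgue_measure R).-integrable `]a, b[ (EFin \o f) ->
  F x @[x --> a^'+] --> l -> F x @[x --> b^'-] --> r ->
  \int[lebesgue_measure]_(x in `]a, b[) f x = r - l.
Proof.
move=> ab dF fi Fl Fr; apply/eqP; rewrite eq_le; apply/andP; split; last first.
  exact: FTC2_le Fl Fr.
have : - r - - l <= \int[lebesgue_measure]_(x in `]a, b[) (- f x).
  apply: (@FTC2_le _ (- F)) => //.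
  - by move=> x /dF ?; exact: is_deriveN.
  - by rewrite (_ : _ \o _ = -%E \o (EFin \o f))//; exact: integrableN.
  - exact: cvgN.
  - exact: cvgN.
under eq_Rintegral do rewrite -mulN1r.
rewrite RintegralZl//.
move: (Rintegral _ _ _) => J; lra.
Qed.

(** The integrals of the truncations min f n are at most r - l, by the increment
    bound applied to - F, and they increase to the integral of f. *)
Lemma ge0_derive_integrable (R : realType) (F f : R -> R) (a b l r : R) :
  a < b ->
  (forall x, a < x < b -> is_derive x 1 F (f x)) ->
  measurable_fun `]a, b[ f ->
  (forall x, a < x < b -> 0 <= f x) ->
  F x @[x --> a^'+] --> l -> F x @[x --> b^'-] --> r ->
  (@lebesgue_measure R).-integrable `]a, b[ (EFin \o f).
Proof.
move=> ab dF mf f0 Fl Fr.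
pose fn (n : nat) x := Num.min (f x) n%:R.
have mfn n : measurable_fun `]a, b[ (fn n) by exact: measurable_minr.
have mefn n : measurable_fun `]a, b[ (EFin \o fn n) by exact/measurable_EFinP.
have mef : measurable_fun `]a, b[ (EFin \o f) by exact/measurable_EFinP.
have fn0 n x : a < x < b -> 0 <= fn n x by move=> /f0 ?; rewrite le_min ler0n andbT.
have fnn n x : fn n x <= n%:R by rewrite ge_min lexx orbT.
have fni n : (@lebesgue_measure R).-integrable `]a, b[ (EFin \o fn n).
  apply: le_integrable (integrable_cst_oo a b n%:R) => //; first exact: mefn.
  move=> x; rewrite /= in_itv/= => /(fn0 n) ?; rewrite lee_fin normr_nat ger0_norm//.
have fnle n : (\int[@lebesgue_measure R]_(x in `]a, b[) (fn n x)%:E <= (r - l)%:E)%E.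
  rewrite -[leLHS]fineK; last exact: (integrable_fin_num _ (fni n)).
  rewrite lee_fin.
  have : - r - - l <= \int[lebesgue_measure]_(x in `]a, b[) (- fn n x).
    apply: (@le_limit_increment_Rintegral _ (- F) (fun x => - f x) _ a b
      (- l) (- r) n%:R) => //.
    - by move=> x /dF ?; exact: is_deriveN.
    - by rewrite (_ : _ \o _ = -%E \o (EFin \o fn n))//; exact: integrableN.
    - by move=> x _; rewrite lerN2.
    - by move=> x _; rewrite lerN2 ge_min lexx.
    - exact: cvgN.
    - exact: cvgN.
  under eq_Rintegral do rewrite -mulN1r.
  rewrite RintegralZl// -/(Rintegral _ _ _).
  move: (Rintegral _ _ _) => J; lra.
apply/integrableP; split; first exact: mef.
apply: (@le_lt_trans _ _ (r - l)%:E); last by rewrite ltry.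
rewrite (_ : \int[_]_(x in _) _ =
  \int[@lebesgue_measure R]_(x in `]a, b[) (f x)%:E)%E; last first.
  by apply: eq_integral => x; rewrite inE/= in_itv/= => /f0 ?; rewrite ger0_norm.
have h : (\int[@lebesgue_measure R]_(x in `]a, b[)
    (limn (fun n => (fn n x)%:E)) <= (r - l)%:E)%E.
  have := @cvg_monotone_convergence _ _ R (@lebesgue_measure R) `]a, b[
    (measurable_itv _) (fun n => EFin \o fn n) mefn.
  move=> /(_ _ _)/cvge_to_le; apply; last by apply: nearW => n; exact: fnle.
  - by move=> n x; rewrite /= in_itv/= => /fn0; rewrite lee_fin.
  - move=> x _ n m nm; rewrite lee_fin /fn le_min ge_min lexx/=.
    by rewrite ge_min ler_nat nm orbT.
apply: le_trans h; rewrite le_eqVlt; apply/orP; left; apply/eqP.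
apply: eq_integral => x _; apply/esym/cvg_lim => //; apply: cvg_near_cst.
exists (Num.truncn `|f x|).+1 => // n /= fxn.
rewrite /fn; congr EFin; apply/min_idPl.
by rewrite (le_trans (ler_norm _))// (le_trans (ltW (truncnS_gt _)))// ler_nat.
Qed.

(** * Affine changes of variables *)

Lemma measurable_affine (R : realType) (k c : R) :
  measurable_fun setT (fun t : R => k * t + c).
Proof. by apply: measurable_funD => //; exact: measurable_funM. Qed.

(** By uniqueness of the Lebesgue measure, comparing both sides on half-open
    intervals suffices; the sign of k decides the orientation of the preimage. *)
Lemma lebesgue_measure_affine (R : realType) (k c : R) (A : set R) :
  k != 0 -> measurable A ->
  lebesgue_measure A =
  (`|k|%:E * lebesgue_measure ((fun t : R => (k * t + c)%R) @^-1` A))%E.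
Proof.
move=> k0 mA.
have mphi : measurable_fun [set: measurableTypeR R]
   ((fun t : R => k * t + c) : measurableTypeR R -> measurableTypeR R).
  exact: measurable_affine.
pose k' : {nonneg R} := NngNum (normr_ge0 k).
(* a pushforward is a measure only along a measurable map, hence the explicit
   proof mphi *)
pose nu : {measure set (measurableTypeR R) -> \bar R} :=
  mscale k'
    (measure_function_pushforward__canonical__measure_function_Measure
       (@lebesgue_measure R) mphi).
have : lebesgue_measure A = nu A.
  apply: lebesgue_measure_unique => //= _ [[a b]] _ <-.
  rewrite /nu /mscale/= /pushforward.
  have [kp|kn|kz] := ltgtP k 0; last by rewrite kz eqxx in k0.
  - rewrite (_ : _ @^-1` _ = `[(b - c) / k, (a - c) / k[); last first.
      apply/seteqP; split => t /=; rewrite !in_itv/= => /andP[];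
        by rewrite ler_ndivrMr// ltr_ndivlMr// mulrC; lra.
    rewrite !lebesgue_measure_itv/= !lte_fin ltr_nM2r ?invr_lt0// ltrD2r.
    case: ifPn => _; last by rewrite mule0.
    by rewrite ltr0_norm// -!EFinB -EFinM; congr EFin; field.
  - rewrite (_ : _ @^-1` _ = `](a - c) / k, (b - c) / k]); last first.
      apply/seteqP; split => t /=; rewrite !in_itv/= => /andP[];
        by rewrite ler_pdivlMr// ltr_pdivrMr// mulrC; lra.
    rewrite !lebesgue_measure_itv/= !lte_fin ltr_pM2r ?invr_gt0// ltrD2r.
    case: ifPn => _; last by rewrite mule0.
    by rewrite gtr0_norm// -!EFinB -EFinM; congr EFin; field.
by [].
Qed.

Lemma ge0_integral_affine (R : realType) (k c : R) (D : set R) (h : R -> \bar R) :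
  k != 0 -> measurable D -> measurable_fun D h -> (forall x, D x -> 0 <= h x)%E ->
  (\int[lebesgue_measure]_(x in D) h x =
   `|k|%:E * \int[lebesgue_measure]_(t in (fun t : R => (k * t + c)%R) @^-1` D)
     h (k * t + c)%R)%E.
Proof.
move=> k0 mD mh h0.
have mphi : measurable_fun [set: measurableTypeR R]
   ((fun t : R => k * t + c) : measurableTypeR R -> measurableTypeR R).
  exact: measurable_affine.
pose k' : {nonneg R} := NngNum (normr_ge0 k).
pose P := measure_function_pushforward__canonical__measure_function_Measure
  (@lebesgue_measure R) mphi.
transitivity (\int[mscale k' P]_(x in D) h x)%E.
  by apply: eq_measure_integral => A mA _; exact: lebesgue_measure_affine.
rewrite ge0_integral_mscale//; congr (_ * _)%E.
rewrite (ge0_integral_pushforward mphi)//.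
by move=> x /[1!inE]; exact: h0.
Qed.

Lemma integrable_affine (R : realType) (k c : R) (D : set R) (h : R -> R) :
  k != 0 -> measurable D -> (@lebesgue_measure R).-integrable D (EFin \o h) ->
  (@lebesgue_measure R).-integrable ((fun t : R => k * t + c) @^-1` D)
    (EFin \o (fun t => h (k * t + c))).
Proof.
move=> k0 mD hi.
have mh : measurable_fun D (EFin \o h) by exact: measurable_int hi.
apply/integrableP; split.
  apply: (@measurable_comp _ _ _ _ _ _ D (EFin \o h)) => //.
    by move=> _ [t Dt <-].
  by apply: measurable_funTS; exact: measurable_affine.
move/integrableP : hi => [_].
rewrite (@ge0_integral_affine _ k c)//.
  rewrite !ltey; apply: contra => /eqP ->.
  by rewrite gt0_muley// lte_fin normr_gt0.
by apply: measurableT_comp.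
Qed.

Lemma Rintegral_affine (R : realType) (k c : R) (D : set R) (h : R -> R) :
  k != 0 -> measurable D -> (@lebesgue_measure R).-integrable D (EFin \o h) ->
  \int[lebesgue_measure]_(x in D) h x =
   `|k| * \int[lebesgue_measure]_(t in (fun t : R => k * t + c) @^-1` D) h (k * t + c).
Proof.
move=> k0 mD hi.
have mh : measurable_fun D (EFin \o h) by exact: measurable_int hi.
have hi' := integrable_affine c k0 mD hi.
have mD' : measurable ((fun t : R => k * t + c) @^-1` D).
  by rewrite -[X in measurable X]setTI; exact: measurable_affine.
rewrite /Rintegral -[`|k|]/(fine `|k|%:E) -fineM//; last first.
  by apply: (integrable_fin_num _ hi'); exact: mD'.
congr fine; rewrite integralE [in RHS]integralE.
rewrite (@ge0_integral_affine _ k c)//; last exact: measurable_funepos.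
rewrite (@ge0_integral_affine _ k c _ (EFin \o h)^\-%E)//; last exact: measurable_funeneg.
rewrite [RHS]muleBr//.
  by congr (_ * _ - _ * _)%E; apply: eq_integral => t _; rewrite ?funeposE ?funenegE.
apply: fin_num_adde_defl; rewrite fin_numN.
by apply: integrable_neg_fin_num; [exact: mD'|exact: hi'].
Qed.

(** * Integration by parts against a power *)

(** Increments of F between interior points are bounded by the integral of
    |f|, which dominates both f and - f. *)
Lemma bounded_derive_integrable (R : realType) (F f : R -> R) (a b : R) :
  a < b -> (forall x, a < x < b -> is_derive x 1 F (f x)) ->
  (@lebesgue_measure R).-integrable `]a, b[ (EFin \o f) ->
  exists K : R, forall x, a < x < b -> `|F x| <= K.
Proof.
move=> ab dF fi.
pose I := \int[lebesgue_measure]_(x in `]a, b[) `|f x|.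
have afi : (@lebesgue_measure R).-integrable `]a, b[ (EFin \o (fun x => `|f x|)).
  exact: integrable_norm.
have incr c d : a < c -> c <= d -> d < b -> `|F d - F c| <= I.
  move=> ac cd db; rewrite ler_norml; apply/andP; split.
    have := @le_increment_Rintegral_ge0 _ (- F) (fun x => - f x) (fun x => `|f x|) a b c d.
    have FN x : (- F) x = - F x by [].
    rewrite !FN lerNl opprB addrC opprK; apply => //.
    - by move=> x /dF ?; exact: is_deriveN.
    - by move=> x _; rewrite -normrN ler_norm.
  apply: (@le_increment_Rintegral_ge0 _ F f (fun x => `|f x|) a b c d) => //.
  by move=> x _; rewrite ler_norm.
pose m := (a + b) / 2.
exists (`|F m| + I) => x /andP[ax xb].
have am : a < m by rewrite /m; lra.
have mb : m < b by rewrite /m; lra.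
rewrite -{1}(subrK (F m) (F x)) (le_trans (ler_normD _ _))// addrC lerD2l.
have [xm|/ltW mx] := leP x m; last exact: incr.
by rewrite distrC; exact: incr.
Qed.

Lemma powR_cvg_at_left (R : realType) (p b : R) : 0 < b ->
  x `^ p @[x --> b^'-] --> b `^ p.
Proof.
move=> b0; apply: cvg_at_left_filter.
have : {for b, continuous (@powR R ^~ p)}; last exact.
apply: differentiable_continuous; apply/derivable1_diffP.
by apply: derivable_powR; rewrite in_itv/= b0.
Qed.

Lemma integrable_powR (R : realType) (p b : R) : 0 < p ->
  (@lebesgue_measure R).-integrable `]0, b[ (EFin \o (fun x => x `^ (p - 1))).
Proof.
move=> p0; have [b0|b0] := leP b 0.
  by rewrite set_itv_ge ?bnd_simp -?leNgt//; exact: integrable_set0.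
have : (@lebesgue_measure R).-integrable `]0, b[
    (EFin \o (fun x => p * x `^ (p - 1))).
  apply: (@ge0_derive_integrable R (@powR R ^~ p) (fun x => p * x `^ (p - 1))
    0 b 0 (b `^ p)) => //.
  - by move=> x /andP[x0 _]; exact: is_derive1_powR.
  - apply: measurable_funM => //; apply: measurable_funTS; exact: measurable_powR.
  - by move=> x /andP[x0 _]; rewrite mulr_ge0 ?powR_ge0// ltW.
  - exact: powR_cvg0.
  - exact: powR_cvg_at_left.
move=> h; have := @integrableZl _ _ _ (@lebesgue_measure R) _ (measurable_itv _) p^-1 _ h.
apply: eq_integrable => // x _ /=.
by rewrite -EFinM mulrA mulVf ?mul1r// gt_eqF.
Qed.

Lemma derive_measurable_itv (R : realType) (F f : R -> R) (a b : R) :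
  (forall x, a < x < b -> is_derive x 1 F (f x)) -> measurable_fun `]a, b[ F.
Proof.
move=> dF; apply: open_continuous_measurable_fun; first exact: interval_open.
move=> x; rewrite inE/= in_itv/= => /dF ?; apply: differentiable_continuous.
exact/derivable1_diffP.
Qed.

(** Fundamental theorem for x^p F(x).  The boundary term at 0 vanishes because
    F is bounded and p > 0; for p < 1 the weight x^(p-1) is unbounded but still
    integrable. *)
Lemma powR_by_parts (R : realType) (F f : R -> R) (p b l : R) :
  0 < p -> 0 < b ->
  (forall x, 0 < x < b -> is_derive x 1 F (f x)) ->
  (@lebesgue_measure R).-integrable `]0, b[ (EFin \o f) ->
  F x @[x --> b^'-] --> l ->
  [/\ (@lebesgue_measure R).-integrable `]0, b[
        (EFin \o (fun x => x `^ (p - 1) * F x)),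
      (@lebesgue_measure R).-integrable `]0, b[
        (EFin \o (fun x => x `^ p * f x)) &
      p * \int[lebesgue_measure]_(x in `]0, b[) (x `^ (p - 1) * F x) =
      b `^ p * l - \int[lebesgue_measure]_(x in `]0, b[) (x `^ p * f x)].
Proof.
move=> p0 b0 dF fi Fl.
have [K FK] := bounded_derive_integrable b0 dF fi.
have mF := derive_measurable_itv dF.
have i1 : (@lebesgue_measure R).-integrable `]0, b[
        (EFin \o (fun x => x `^ (p - 1) * F x)).
  have := @integrableMl _ _ _ (@lebesgue_measure R) `]0, b[ (measurable_itv _)
    _ F (integrable_powR b p0) mF.
  apply; exists K; split; first exact: num_real.
  by move=> M /ltW KM x /=; rewrite in_itv/= => /FK /le_trans; exact.
have i2 : (@lebesgue_measure R).-integrable `]0, b[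
        (EFin \o (fun x => x `^ p * f x)).
  have := @integrableMr _ _ _ (@lebesgue_measure R) `]0, b[ (measurable_itv _)
    (@powR R ^~ p) (EFin \o f).
  apply => //; first by apply: measurable_funTS; exact: measurable_powR.
  exists (b `^ p); split; first exact: num_real.
  move=> M /ltW KM x /=; rewrite in_itv/= => /andP[x0 xb].
  rewrite ger0_norm ?powR_ge0// (le_trans _ KM)//.
  by apply: ge0_ler_powR; rewrite ?nnegrE ltW.
split => //.
have i1' : (@lebesgue_measure R).-integrable `]0, b[
        (EFin \o (fun x => p * (x `^ (p - 1) * F x))).
  exact: (@integrableZl _ _ _ (@lebesgue_measure R) _ (measurable_itv _) p _ i1).
have : \int[lebesgue_measure]_(x in `]0, b[)
    (p * (x `^ (p - 1) * F x) + x `^ p * f x) = b `^ p * l - 0.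
  apply: (@FTC2_integrable _ (fun x => x `^ p * F x)) => //.
  - move=> x /[dup] xb /andP[x0 _].
    have ? := dF _ xb.
    have ? := is_derive1_powR p x0.
    have -> : p * (x `^ (p - 1) * F x) + x `^ p * f x =
      x `^ p *: f x + F x *: (p * x `^ (p - 1)).
      by rewrite /GRing.scale/=; ring.
    exact: is_deriveM.
  - exact: (@integrableD _ _ _ (@lebesgue_measure R) _ (measurable_itv _) _ _ i1' i2).
  - apply: cvg_zero; rewrite subr0.
    have K0 : 0 <= K by apply: le_trans (FK (b / 2) _); rewrite //; lra.
    have h : K * x `^ p @[x --> 0^'+] --> 0.
      by rewrite -[X in _ --> X](mulr0 K); apply: cvgMr; exact: powR_cvg0.
    have hN : - (K * x `^ p) @[x --> 0^'+] --> 0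
      by rewrite -[X in _ --> X]oppr0; exact: cvgN.
    apply: (squeeze_cvgr _ hN h); near=> x.
    rewrite -ler_norml normrM ger0_norm ?powR_ge0// mulrC.
    apply: ler_wpM2r; first exact: powR_ge0.
    by apply: FK; apply/andP; split; near: x;
      [exact: nbhs_right_gt|exact: nbhs_right_lt].
  - by apply: cvgM => //; exact: powR_cvg_at_left.
rewrite subr0 RintegralD// RintegralZl//.
by move=> <-; rewrite addrK.
Unshelve. all: by end_near. Qed.

(** * The functional equation of the Gamma function *)

(** With y = x / (2p), the inequality y <= exp y raised to the power p reads
    x^p <= (2p)^p exp (x / 2). *)
Lemma powR_expRN_le (R : realType) (p : R) : 0 < p ->
  exists2 C : R, 0 <= C & forall x, 0 <= x ->
    expR (- x) * x `^ p <= C * expR (- (2^-1 * x)).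
Proof.
move=> p0; exists ((2 * p) `^ p); first exact: powR_ge0.
move=> x x0.
pose y := x / (2 * p).
have y0 : 0 <= y by rewrite divr_ge0// mulr_ge0// ltW.
have xy : x = (2 * p) * y by rewrite mulrC divfK// mulf_neq0// gt_eqF.
have yp : y * p = 2^-1 * x by rewrite /y; field; rewrite gt_eqF.
rewrite {2}xy powRM //; last by rewrite mulr_ge0 // ltW.
have h : y `^ p <= expR (2^-1 * x).
  rewrite -yp expRM; apply: ge0_ler_powR; rewrite ?nnegrE ?expR_ge0 ?(ltW p0)//.
  by apply: le_trans (expR_ge1Dx y); rewrite lerDr.
have -> : expR (- (2^-1 * x)) = expR (- x) * expR (2^-1 * x).
  by rewrite -expRD; congr expR; field.
rewrite mulrCA; apply: ler_wpM2l; first exact: powR_ge0.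
by apply: ler_wpM2l => //; exact: expR_ge0.
Qed.

Local Notation gamma_integral p :=
  (\int[lebesgue_measure]_(u in `[0%R, +oo[) (expR (- u) * u `^ (p - 1))%:E)%E.

Lemma measurable_gamma (R : realType) (p : R) (D : set R) : measurable D ->
  measurable_fun D (fun u : R => (expR (- u) * u `^ (p - 1))%:E).
Proof.
move=> mD; apply/measurable_EFinP; apply: measurable_funTS.
apply: measurable_funM; last exact: measurable_powR.
by apply: measurableT_comp => //; exact: measurable_expR.
Qed.

(** The integrand is dominated by a multiple of an exponential density. *)
Lemma gamma_integral_lty (R : realType) (p : R) : 0 < p ->
  (gamma_integral (p + 1) < +oo)%E.
Proof.
move=> p0; have [C C0 hC] := powR_expRN_le p0.
have r0 : 0 < 2^-1 :> R by rewrite invr_gt0.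
pose g x := ((2 * C)%:E * (exponential_pdf (2^-1 : R) x)%:E)%E.
have mpdf : measurable_fun setT (fun x => (exponential_pdf (2^-1 : R) x)%:E).
  by apply/measurable_EFinP; exact: measurable_exponential_pdf.
have pdf0 x : (0 <= (exponential_pdf (2^-1 : R) x)%:E)%E.
  by rewrite lee_fin exponential_pdf_ge0// ltW.
apply: (@le_lt_trans _ _ (\int[lebesgue_measure]_x g x)%E); last first.
  rewrite ge0_integralZl_EFin//; last by rewrite mulr_ge0.
  by rewrite integral_exponential_pdf// mule1 ltry.
apply: (@le_trans _ _ (\int[lebesgue_measure]_(x in `[0%R, +oo[) g x)%E).
  apply: ge0_le_integral => //.
  - by move=> x _; rewrite lee_fin mulr_ge0 ?expR_ge0 ?powR_ge0.
  - exact: measurable_gamma.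
  - by apply: measurable_funTS; apply: emeasurable_funM.
  - move=> x; rewrite /= in_itv/= andbT => x0.
    rewrite /g exponential_pdfE// -EFinM lee_fin addrK.
    apply: (le_trans (hC _ x0)); rewrite mulNr -/(_ * _).
    set e := expR _; rewrite le_eqVlt; apply/orP; left; apply/eqP; by field.
apply: (@ge0_subset_integral _ _ R (@lebesgue_measure R) `[0%R, +oo[ setT
  (measurable_itv _) measurableT g) => //; first by apply: emeasurable_funM.
by move=> x _; rewrite /g mule_ge0// lee_fin mulr_ge0.
Qed.

(** On [1, 2] the integrand is at least exp (- 2). *)
Lemma gamma_integral_gt0 (R : realType) (p : R) : 0 < p ->
  (0 < gamma_integral (p + 1))%E.
Proof.
move=> p0.
apply: (@lt_le_trans _ _ (expR (- 2%:R : R))%:E); first by rewrite lte_fin expR_gt0.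
apply: (@le_trans _ _ (\int[lebesgue_measure]_(u in `[1%R, 2%R])
  (expR (- u) * u `^ (p + 1 - 1))%:E)%E); last first.
  apply: ge0_subset_integral => //.
  - exact: measurable_gamma.
  - by move=> x _; rewrite lee_fin mulr_ge0 ?expR_ge0 ?powR_ge0.
  - by move=> x /=; rewrite !in_itv/= => /andP[x1 _]; rewrite andbT (le_trans _ x1).
apply: (@le_trans _ _ (\int[lebesgue_measure]_(u in `[1%R, 2%R])
  (expR (- 2%:R : R))%:E)%E).
  rewrite (@integral_cst _ _ _ (@lebesgue_measure R))//= lebesgue_measure_itv/= lte_fin.
  by rewrite ifT ?ltr1n// -EFinB -EFinM lee_fin (_ : 2 - 1 = 1) ?mulr1//; lra.
apply: ge0_le_integral => //.
- exact: measurable_gamma.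
- move=> x /=; rewrite in_itv/= => /andP[x1 x2]; rewrite lee_fin addrK.
  rewrite -[leLHS]mulr1; apply: ler_pM => //; first by rewrite ler_expR lerN2.
  have : 1 `^ p <= x `^ p.
    by apply: ge0_ler_powR; rewrite ?nnegrE ?(ltW p0)// (le_trans _ x1).
  by rewrite powR1.
Qed.

(** Integrate by parts over (0, n) and let n tend to infinity.  The equation
    holds in the extended reals, so no finiteness is presupposed; the finiteness
    of the integral at p is then deduced from that at p + 1. *)
Lemma gamma_integral_rec (R : realType) (p : R) : 0 < p ->
  (gamma_integral (p + 1) = p%:E * gamma_integral p)%E.
Proof.
move=> p0.
pose I (q : R) (n : nat) := (\int[lebesgue_measure]_(u in `]0%R, n%:R[)
  (expR (- u) * u `^ (q - 1))%:E)%E.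
have cI q : I q n @[n --> \oo] --> gamma_integral q.
  rewrite -integral_itv_obnd_cbnd; last exact: measurable_gamma.
  have -> : `]0, +oo[%classic = \bigcup_n `]0, n%:R[%classic :> set R.
    apply/seteqP; split => x /=.
      rewrite in_itv/= andbT => x0; exists (Num.truncn x).+1 => //=.
      by rewrite in_itv/= x0 truncnS_gt.
    by move=> [n _]; rewrite /= !in_itv/= andbT => /andP[].
  apply: ge0_nondecreasing_set_cvg_integral.
  - move=> m n mn; apply/subsetPset => x /=; rewrite !in_itv/= => /andP[-> xm].
    by rewrite (lt_le_trans xm)// ler_nat.
  - by [].
  - by move=> n; exact: measurable_gamma.
  - by move=> n x _; rewrite lee_fin mulr_ge0 ?expR_ge0 ?powR_ge0.
have rec n : (p%:E * I p n.+1 =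
    (n.+1%:R `^ p * expR (- n.+1%:R))%:E + I (p + 1)%R n.+1)%E.
  have n0 : 0 < n.+1%:R :> R by [].
  have dF (x : R) : 0 < x < n.+1%:R ->
      is_derive x 1 (fun u : R => expR (- u)) (- expR (- x)).
    by move=> _; apply: is_derive_eq; rewrite /GRing.scale/= mulrN1.
  have fi : (@lebesgue_measure R).-integrable `]0, n.+1%:R[
      (EFin \o (fun x : R => - expR (- x))).
    apply: le_integrable (integrable_cst_oo 0 n.+1%:R 1) => //.
      apply/measurable_EFinP; apply: measurable_funTS.
      by do 2 apply: measurableT_comp => //; exact: measurable_expR.
    move=> x; rewrite /= in_itv/= => /andP[x0 _].
    by rewrite lee_fin normrN normr1 ger0_norm ?expR_ge0// expR_le1 oppr_le0 ltW.
  have Fl : expR (- x) @[x --> n.+1%:R^'-] --> expR (- n.+1%:R : R).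
    apply: cvg_at_left_filter.
    apply: (@cvg_comp _ _ _ -%R expR); last exact: continuous_expR.
    exact: opp_continuous.
  have [i1 i2 i3] := powR_by_parts p0 n0 dF fi Fl.
  pose J1 := \int[lebesgue_measure]_(x in `]0, n.+1%:R[) (x `^ (p - 1) * expR (- x)).
  pose J2 := \int[lebesgue_measure]_(x in `]0, n.+1%:R[) (x `^ p * - expR (- x)).
  have e1 : I p n.+1 = J1%:E.
    rewrite /J1 /Rintegral fineK; last first.
      by apply: (integrable_fin_num _ i1); exact: measurable_itv.
    by apply: eq_integral => x _; rewrite mulrC.
  have e2 : I (p + 1) n.+1 = (- J2)%:E.
    rewrite EFinN /J2 /Rintegral fineK; last first.
      by apply: (integrable_fin_num _ i2); exact: measurable_itv.
    rewrite -integralN/=; last first.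
      apply: fin_num_adde_defl; rewrite fin_numN.
      by apply: (integrable_neg_fin_num _ i2); exact: measurable_itv.
    by apply: eq_integral => x _; rewrite mulrN opprK addrK mulrC.
  by rewrite e1 e2 -EFinM i3.
have lim0 : n.+1%:R `^ p * expR (- n.+1%:R) @[n --> \oo] --> (0 : R).
  have [C C0 hC] := powR_expRN_le p0.
  have h : C * expR (- (2^-1 * n.+1%:R)) @[n --> \oo] --> 0.
    rewrite -[X in _ --> X](mulr0 C); apply: cvgMr.
    have hx : expR (- (2^-1 * x)) @[x --> +oo] --> (0 : R).
      apply: (@cvg_comp _ _ _ (fun x : R => 2^-1 * x) (fun x => expR (- x)) _ +oo);
        last exact: cvgr_expR.
      by apply: gt0_cvgMry; [rewrite invr_gt0|exact: cvg_id].
    apply: (@cvg_comp _ _ _ (fun n : nat => n.+1%:R : R)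
      (fun x => expR (- (2^-1 * x))) _ (pinfty_nbhs R)); last exact: hx.
    by rewrite (cvg_shiftS (fun n => n%:R : R)); exact: cvgr_idn.
  apply: (squeeze_cvgr _ (cvg_cst 0) h); apply: nearW => n.
  by rewrite mulr_ge0 ?powR_ge0 ?expR_ge0//= mulrC hC.
have c1 : (p%:E * I p n.+1)%E @[n --> \oo] --> (p%:E * gamma_integral p)%E.
  apply: cvgeZl => //.
  by rewrite (cvg_shiftS (I p)); exact: cI.
have c2 : ((n.+1%:R `^ p * expR (- n.+1%:R))%:E + I (p + 1)%R n.+1)%E
    @[n --> \oo] --> (0 + gamma_integral (p + 1))%E.
  apply: cvgeD => //.
  - by apply: cvg_EFin; [exact: nearW|exact: lim0].
  - by rewrite (cvg_shiftS (I (p + 1))); exact: cI.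
move: c1; under eq_fun do rewrite rec; move=> c1.
by rewrite -[LHS]add0e; apply: (cvg_unique _ c2 c1); exact: ereal_hausdorff.
Qed.

Lemma EulerGamma_rec (R : realType) (p : R) : 0 < p ->
  EulerGamma (p + 1) = p * EulerGamma p /\ EulerGamma p != 0.
Proof.
move=> p0.
have E := gamma_integral_rec p0.
have gt0 := gamma_integral_gt0 p0.
have lty := gamma_integral_lty p0.
have Gfin : gamma_integral p \is a fin_num.
  rewrite ge0_fin_numE; last first.
    by apply: integral_ge0 => x _; rewrite lee_fin mulr_ge0 ?expR_ge0 ?powR_ge0.
  rewrite ltey; apply: contraTneq lty => h; rewrite E h.
  by rewrite gt0_muley ?lte_fin.
have EG : EulerGamma (p + 1) = p * EulerGamma p.
  by rewrite /EulerGamma /Rintegral E fineM.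
split=> //; apply/eqP => h.
have : 0 < EulerGamma (p + 1) by rewrite /EulerGamma /Rintegral fine_gt0// gt0 lty.
by rewrite EG h mulr0 ltxx.
Qed.

(** * The identity on one side of x *)

Lemma cvg_affine_at_left_pos (R : realType) (k c : R) : 0 < k ->
  k * s + c @[s --> 1^'-] --> (k + c)^'-.
Proof.
move=> k0 A nA.
have cont : k * s + c @[s --> 1^'-] --> k + c.
  apply: cvg_at_left_filter; rewrite -[X in X + c]mulr1.
  by apply: cvgD; [apply: cvgMr; exact: cvg_id|exact: cvg_cst].
have h : \forall s \near 1^'-, k * s + c < k + c -> A (k * s + c) := cont _ nA.
change (\forall s \near 1^'-, A (k * s + c)); near=> s.
apply: (near h s) => //; rewrite ltrD2r gtr_pMr//; near: s; exact: nbhs_left_lt.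
Unshelve. all: by end_near. Qed.

Lemma cvg_affine_at_left_neg (R : realType) (k c : R) : k < 0 ->
  k * s + c @[s --> 1^'-] --> (k + c)^'+.
Proof.
move=> k0 A nA.
have cont : k * s + c @[s --> 1^'-] --> k + c.
  apply: cvg_at_left_filter; rewrite -[X in X + c]mulr1.
  by apply: cvgD; [apply: cvgMr; exact: cvg_id|exact: cvg_cst].
have h : \forall s \near 1^'-, k + c < k * s + c -> A (k * s + c) := cont _ nA.
change (\forall s \near 1^'-, A (k * s + c)); near=> s.
apply: (near h s) => //; rewrite ltrD2r ltr_nMr//; near: s; exact: nbhs_left_lt.
Unshelve. all: by end_near. Qed.

(** With x = k + c, O is the open interval between c and x, whatever the sign
    of k.  On the right-hand side, k without absolute value comes from the chain
    rule: its sign distinguishes the two terms of the theorem.  The integrability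
    conclusions allow the end points to be added to the domains. *)
Lemma fractional_segment_identity (R : realType) (f : R -> R) (c k l alpha : R)
    (O := [set u : R | 0 < (u - c) / k < 1]) :
  k != 0 -> 0 < alpha ->
  (forall u, O u -> derivable f u 1) ->
  (@lebesgue_measure R).-integrable O (EFin \o derive1 f) ->
  f (k * s + c) @[s --> 1^'-] --> l ->
  [/\ (@lebesgue_measure R).-integrable O
        (EFin \o (fun u => `|u - c| `^ (alpha - 1) * f u)),
      (@lebesgue_measure R).-integrable `]0, 1[
        (EFin \o (fun s => s `^ alpha * derive1 f (k * s + c))) &
      `|k| `^ alpha * l -
        alpha * \int[lebesgue_measure]_(u in O) (`|u - c| `^ (alpha - 1) * f u) =
      `|k| `^ alpha * k *
        \int[lebesgue_measure]_(s in `]0, 1[) (s `^ alpha * derive1 f (k * s + c))].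
Proof.
move=> k0 a0 df fi Fl.
have kn0 : 0 < `|k| by rewrite normr_gt0.
have OE : (fun u => k^-1 * u + - (c / k)) @^-1` `]0, 1[ = O.
  by apply/seteqP; split => u /=; rewrite in_itv/=;
    rewrite (_ : k^-1 * u + - (c / k) = (u - c) / k)//; field.
have O01 : (fun s => k * s + c) @^-1` O = `]0, 1[.
  by apply/seteqP; split => s; rewrite /O/= in_itv/= addrK mulrAC mulfV// mul1r.
have mO : measurable O.
  by rewrite -OE -[X in measurable X]setTI; exact: measurable_affine.
pose F s := f (k * s + c).
have dF (s : R) : 0 < s < 1 -> is_derive s 1 F (k * derive1 f (k * s + c)).
  move=> s01.
  have Os : O (k * s + c) by rewrite /O/= addrK mulrAC mulfV// mul1r.
  have ? : is_derive s 1 (fun s : R => k * s + c) k.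
    have -> : (fun s : R => k * s + c) = (k \*: id : R -> R) + cst c by [].
    by apply: is_derive_eq; rewrite addr0 [_ *: _]mulr1.
  have ? : is_derive (k * s + c) 1 f (derive1 f (k * s + c)).
    by rewrite derive1E; apply: DeriveDef => //; exact: df.
  rewrite mulrC; exact: is_derive1_comp.
have f'i : (@lebesgue_measure R).-integrable `]0, 1[
    (EFin \o (fun s => derive1 f (k * s + c))).
  by rewrite -O01; exact: integrable_affine.
have F'i : (@lebesgue_measure R).-integrable `]0, 1[
    (EFin \o (fun s => k * derive1 f (k * s + c))).
  exact: (@integrableZl _ _ _ (@lebesgue_measure R) _ (measurable_itv _) k _ f'i).
have [i1 i2 i3] := powR_by_parts a0 ltr01 dF F'i Fl.
have ki0 : k^-1 != 0 by rewrite invr_eq0.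
have pull u : O u -> `|u - c| `^ (alpha - 1) * f u =
   `|k| `^ (alpha - 1) *
   ((k^-1 * u + - (c / k)) `^ (alpha - 1) * F (k^-1 * u + - (c / k))).
  move=> Ou.
  have -> : k^-1 * u + - (c / k) = (u - c) / k by field.
  have -> : F ((u - c) / k) = f u by rewrite /F; congr f; field.
  rewrite mulrA; congr (_ * _).
  have uk : 0 <= (u - c) / k by move: Ou => /andP[/ltW].
  rewrite -powRM//; congr powR.
  by rewrite -[X in _ = _ * X](ger0_norm uk) normrM normfV mulrCA divff ?mulr1// gt_eqF.
have j1 := @integrable_affine _ _ (- (c / k)) _ _ ki0 (measurable_itv _) i1.
rewrite OE in j1.
have J1 := @Rintegral_affine _ _ (- (c / k)) _ _ ki0 (measurable_itv _) i1.
rewrite OE in J1.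
have g1 : (@lebesgue_measure R).-integrable O
        (EFin \o (fun u => `|u - c| `^ (alpha - 1) * f u)).
  have := @integrableZl _ _ _ (@lebesgue_measure R) _ mO (`|k| `^ (alpha - 1)) _ j1.
  by apply: eq_integrable => // u; rewrite inE => /pull /= ->.
have g2 : (@lebesgue_measure R).-integrable `]0, 1[
        (EFin \o (fun s => s `^ alpha * derive1 f (k * s + c))).
  have := @integrableZl _ _ _ (@lebesgue_measure R) _ (measurable_itv _) k^-1 _ i2.
  by apply: eq_integrable => // u _ /=; rewrite -EFinM; congr EFin; field.
split => //.
have -> : \int[lebesgue_measure]_(u in O) (`|u - c| `^ (alpha - 1) * f u) =
   `|k| `^ alpha * \int[lebesgue_measure]_(s in `]0, 1[) (s `^ (alpha - 1) * F s).
  rewrite J1 -(mulr_powRB1 (ltW kn0) a0) normfV mulrA (mulrAC `|k|) divff ?gt_eqF// mul1r.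
  rewrite -RintegralZl//.
  by apply: eq_Rintegral => u; rewrite inE => /pull.
have e3 : \int[lebesgue_measure]_(s in `]0, 1[) (s `^ alpha * (k * derive1 f (k * s + c))) =
   k * \int[lebesgue_measure]_(s in `]0, 1[) (s `^ alpha * derive1 f (k * s + c)).
  by rewrite -RintegralZl//; apply: eq_Rintegral => s _; rewrite mulrCA.
rewrite mulrCA i3 e3 powR1; ring.
Qed.

Lemma Rintegral_cc_oo (R : realType) (a b : R) (f : R -> R) :
  (@lebesgue_measure R).-integrable `]a, b[ (EFin \o f) ->
  \int[lebesgue_measure]_(x in `[a, b]) f x = \int[lebesgue_measure]_(x in `]a, b[) f x.
Proof.
move=> fi; rewrite /Rintegral; congr fine.
by apply: integral_itv_bndoo; exact: measurable_int fi.
Qed.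

Lemma mulfMVK (F : fieldType) (x y z : F) : y != 0 -> x * y * (y^-1 * z) = x * z.
Proof. by move=> y0; rewrite mulrA mulfK. Qed.

Lemma powR_addr1 (R : realType) (y p : R) : 0 < y -> y `^ (p + 1) = y `^ p * y.
Proof.
move=> y0; rewrite powRD; first by rewrite powRr1// ltW.
by apply/implyP => _; rewrite gt_eqF.
Qed.

(** If a = x, both sides vanish: the integral over [x, x] is 0 and the positive
    powers of 0 are 0. *)
Lemma RL_right_identity (R : realType) (f : R -> R) (a x alpha : R) :
  a <= x -> 0 < alpha ->
  (forall y, a < y < x -> derivable f y 1) ->
  (@lebesgue_measure R).-integrable `]a, x[ (EFin \o derive1 f) ->
  (a < x -> f t @[t --> x^'-] --> f x) ->
  (x - a) `^ alpha * f x - EulerGamma (alpha + 1) * RL_right alpha x f a =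
  (x - a) `^ (alpha + 1) *
    \int[lebesgue_measure]_(t in `[0, 1]) (t `^ alpha * derive1 f (t * x + (1 - t) * a)).
Proof.
move=> ax a0 df fi fl; have [GE G0] := EulerGamma_rec a0.
have a10 : alpha + 1 != 0 by rewrite gt_eqF// addr_gt0.
move: ax; rewrite le_eqVlt => /predU1P[xa|ax].
  rewrite /RL_right -xa set_itv1 Rintegral_set1 subrr !powR0// ?gt_eqF//.
  by rewrite !mul0r !mulr0 subrr.
have k0 : 0 < x - a by rewrite subr_gt0.
have O_ : [set u : R | 0 < (u - a) / (x - a) < 1] = `]a, x[.
  apply/seteqP; split => u /=; rewrite in_itv/= pmulr_lgt0 ?invr_gt0// ltr_pdivrMr// mul1r;
  by rewrite subr_gt0 ltrD2r.
have [] := @fractional_segment_identity _ f a (x - a) (f x) alpha.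
- by rewrite gt_eqF.
- exact: a0.
- by move=> u; rewrite O_/= in_itv/=; exact: df.
- by rewrite O_.
- have := @cvg_affine_at_left_pos R _ a k0; rewrite subrK => h.
  by apply: (@cvg_comp _ _ _ (fun s => (x - a) * s + a) f _ x^'-); [exact: h|exact: fl].
rewrite O_ (gtr0_norm k0) => i1 i2 E.
have J1 : \int[lebesgue_measure]_(t in `[a, x]) ((t - a) `^ (alpha - 1) * f t) =
    \int[lebesgue_measure]_(u in `]a, x[) (`|u - a| `^ (alpha - 1) * f u).
  rewrite -(Rintegral_cc_oo i1); apply: eq_Rintegral => t.
  rewrite inE/= in_itv/= => /andP[at_ tb].
  by rewrite ger0_norm ?subr_ge0.
have J2 : \int[lebesgue_measure]_(t in `[0, 1])
      (t `^ alpha * derive1 f (t * x + (1 - t) * a)) =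
    \int[lebesgue_measure]_(s in `]0, 1[)
      (s `^ alpha * derive1 f ((x - a) * s + a)).
  rewrite -(Rintegral_cc_oo i2); apply: eq_Rintegral => t _.
  by congr (_ * derive1 f _); ring.
have J : EulerGamma (alpha + 1) * RL_right alpha x f a =
    alpha * \int[lebesgue_measure]_(u in `]a, x[) (`|u - a| `^ (alpha - 1) * f u).
  by rewrite /RL_right J1 GE mulfMVK.
rewrite J J2; apply: (etrans E).
by rewrite (powR_addr1 alpha k0).
Qed.

Lemma RL_left_identity (R : realType) (f : R -> R) (b x alpha : R) :
  x <= b -> 0 < alpha ->
  (forall y, x < y < b -> derivable f y 1) ->
  (@lebesgue_measure R).-integrable `]x, b[ (EFin \o derive1 f) ->
  (x < b -> f t @[t --> x^'+] --> f x) ->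
  (b - x) `^ alpha * f x - EulerGamma (alpha + 1) * RL_left alpha x f b =
  - ((b - x) `^ (alpha + 1) *
    \int[lebesgue_measure]_(t in `[0, 1]) (t `^ alpha * derive1 f (t * x + (1 - t) * b))).
Proof.
move=> xb a0 df fi fl; have [GE G0] := EulerGamma_rec a0.
have a10 : alpha + 1 != 0 by rewrite gt_eqF// addr_gt0.
move: xb; rewrite le_eqVlt => /predU1P[xb|xb].
  rewrite /RL_left -xb set_itv1 Rintegral_set1 subrr !powR0// ?gt_eqF//.
  by rewrite !mul0r !mulr0 subrr oppr0.
have k0 : x - b < 0 by rewrite subr_lt0.
have k0' : 0 < b - x by rewrite subr_gt0.
have O_ : [set u : R | 0 < (u - b) / (x - b) < 1] = `]x, b[.
  apply/seteqP; split => u /=; rewrite in_itv/= nmulr_lgt0 ?invr_lt0// ltr_ndivrMr// mul1r;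
  by rewrite subr_lt0 ltrD2r andbC.
have [] := @fractional_segment_identity _ f b (x - b) (f x) alpha.
- by rewrite lt_eqF.
- exact: a0.
- by move=> u; rewrite O_/= in_itv/=; exact: df.
- by rewrite O_.
- have := @cvg_affine_at_left_neg R _ b k0; rewrite subrK => h.
  by apply: (@cvg_comp _ _ _ (fun s => (x - b) * s + b) f _ x^'+); [exact: h|exact: fl].
rewrite O_ (ltr0_norm k0) opprB => i1 i2 E.
have J1 : \int[lebesgue_measure]_(t in `[x, b]) ((b - t) `^ (alpha - 1) * f t) =
    \int[lebesgue_measure]_(u in `]x, b[) (`|u - b| `^ (alpha - 1) * f u).
  rewrite -(Rintegral_cc_oo i1); apply: eq_Rintegral => t.
  rewrite inE/= in_itv/= => /andP[at_ tb].
  by rewrite ler0_norm ?subr_le0// opprB.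
have J2 : \int[lebesgue_measure]_(t in `[0, 1])
      (t `^ alpha * derive1 f (t * x + (1 - t) * b)) =
    \int[lebesgue_measure]_(s in `]0, 1[)
      (s `^ alpha * derive1 f ((x - b) * s + b)).
  rewrite -(Rintegral_cc_oo i2); apply: eq_Rintegral => t _.
  by congr (_ * derive1 f _); ring.
have J : EulerGamma (alpha + 1) * RL_left alpha x f b =
    alpha * \int[lebesgue_measure]_(u in `]x, b[) (`|u - b| `^ (alpha - 1) * f u).
  by rewrite /RL_left J1 GE mulfMVK.
rewrite J J2; apply: (etrans E).
by rewrite (powR_addr1 alpha k0') -mulNr -mulrN opprB.
Qed.

Theorem lemma2 (R : realType) (a b : R) (hab : a < b) (f : R -> R)
  (hdiff : forall y : R, a < y < b -> derivable f y 1)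
  (hint : (@lebesgue_measure R).-integrable `[a, b] (EFin \o derive1 f))
  (x : R) (hx : a <= x <= b)
  (* one-sided continuity is needed only when x is that very endpoint *)
  (hxa : x = a -> f t @[t --> a^'+] --> f a)
  (hxb : x = b -> f t @[t --> b^'-] --> f b)
  (alpha : R) (halpha : 0 < alpha) :
  ((x - a) `^ alpha + (b - x) `^ alpha) / (b - a) * f x
    - EulerGamma (alpha + 1) / (b - a)
      * (RL_right alpha x f a + RL_left alpha x f b)
  = (x - a) `^ (alpha + 1) / (b - a)
      * (\int[lebesgue_measure]_(t in `[0, 1])
           (t `^ alpha * derive1 f (t * x + (1 - t) * a)))
    - (b - x) `^ (alpha + 1) / (b - a)
      * (\int[lebesgue_measure]_(t in `[0, 1])
           (t `^ alpha * derive1 f (t * x + (1 - t) * b))).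
Proof.
have [ax xb] := andP hx.
have cont y : a < y < b -> {for y, continuous f}.
  by move=> /hdiff dy; apply: differentiable_continuous; exact/derivable1_diffP.
have L : (x - a) `^ alpha * f x - EulerGamma (alpha + 1) * RL_right alpha x f a =
  (x - a) `^ (alpha + 1) *
    \int[lebesgue_measure]_(t in `[0, 1]) (t `^ alpha * derive1 f (t * x + (1 - t) * a)).
  apply: RL_right_identity => //.
  - by move=> y /andP[ay yx]; apply: hdiff; rewrite ay (lt_le_trans yx).
  - apply: integrableS hint => //; apply: subset_itv; rewrite bnd_simp//.
  - move=> ltax; have [xb'|bx] := ltP x b.
      by apply: cvg_at_left_filter; apply: cont; rewrite ltax.
    have E : x = b by apply/eqP; rewrite eq_le xb.
    by rewrite E; exact: hxb.
have Rt : (b - x) `^ alpha * f x - EulerGamma (alpha + 1) * RL_left alpha x f b =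
  - ((b - x) `^ (alpha + 1) *
    \int[lebesgue_measure]_(t in `[0, 1]) (t `^ alpha * derive1 f (t * x + (1 - t) * b))).
  apply: RL_left_identity => //.
  - by move=> y /andP[xy yb]; apply: hdiff; rewrite yb (le_lt_trans ax).
  - apply: integrableS hint => //; apply: subset_itv; rewrite bnd_simp//.
  - move=> ltxb; have [ax'|xa] := ltP a x.
      by apply: cvg_at_right_filter; apply: cont; rewrite ax'.
    have E : x = a by apply/eqP; rewrite eq_le ax andbT.
    by rewrite E; exact: hxa.
transitivity ((((x - a) `^ alpha * f x - EulerGamma (alpha + 1) * RL_right alpha x f a) +
  ((b - x) `^ alpha * f x - EulerGamma (alpha + 1) * RL_left alpha x f b)) / (b - a)).
  ring.
(* over variables, so that ring does not have to compare the integrals *)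
have distr (P I Q J d : R) : (P * I - Q * J) / d = P / d * I - Q / d * J by ring.
by rewrite L Rt; exact: distr.
Qed.
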